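(* Let $\frac{3}{4} < \alpha < 1$ be a constant, let $p_n = n^{-\alpha}$, and let $G \sim G(n,p_n)$. Then with high probability $G$ cannot be reconstructed from its $2$-neighborhoods. That is, the probability that there exists a graph $H$ on the vertex set $[n]$ with $G \sim_2 H$ and $H$ not isomorphic to $G$ tends to $1$ as $n \to \infty$.
   Context: All graphs are simple and undirected, with labeled vertex set $V = [n] = \{1,\dots,n\}$. $G(n,p_n)$ is the Erdős–Rényi random graph on $[n]$: each pair of distinct vertices is an edge independently with probability $p_n$. ''With high probability'' means with probability tending to $1$ as $n \to \infty$. For a vertex $v$ of a graph $G$, $\mathcal{N}_r(v)$ is the subgraph of $G$ induced by all vertices at graph distance at most $r$ from $v$. For each $v \in V$ one observes $\mathcal{N}_r(v)$ with the central vertex $v$ labeled and all other vertices unlabeled. For two graphs $H_1, H_2$ on $V$, write $H_1 \sim_r H_2$ (they have the same $r$-neighborhoods) if for every $v \in V$ the $r$-neighborhood of $v$ in $H_1$ is isomorphic to the $r$-neighborhood of $v$ in $H_2$ (by an isomorphism fixing the labeled center $v$). $G$ is reconstructable from its $r$-neighborhoods if every graph $H$ on $V$ with $G \sim_r H$ is isomorphic to $G$. *)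

(* Defs.v *)
From HB Require Import structures.
From mathcomp Require Import all_boot all_order all_algebra.
From mathcomp Require Import all_classical all_reals all_analysis.

Set Implicit Arguments.
Unset Strict Implicit.
Unset Printing Implicit Defensive.

Import Order.TTheory GRing.Theory Num.Theory.
Import numFieldNormedType.Exports.

Local Open Scope ring_scope.

Definition edge_axiom (T : finType) (E : {set {set T}}) : bool :=
  [forall e in E, #|e| == 2%N].

Record sgraph (T : finType) := SGraph {
  edges : {set {set T}};
  edgesP : edge_axiom edges
}.

HB.instance Definition _ (T : finType) := [isSub for @edges T].
HB.instance Definition _ (T : finType) := [Equality of sgraph T by <:].
HB.instance Definition _ (T : finType) := [Choice of sgraph T by <:].
HB.instance Definition _ (T : finType) := [Countable of sgraph T by <:].
HB.instance Definition _ (T : finType) := [Finite of sgraph T by <:].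

Definition adj (T : finType) (G : sgraph T) : rel T :=
  fun x y => [set x; y] \in edges G.

Definition is_giso (T U : finType) (G : sgraph T) (H : sgraph U)
    (f : T -> U) : Prop :=
  bijective f /\ forall x y, adj H (f x) (f y) = adj G x y.

Definition isomorphic (T U : finType) (G : sgraph T) (H : sgraph U) : Prop :=
  exists f : T -> U, is_giso G H f.

Definition rooted_isomorphic (T U : finType) (G : sgraph T) (x : T)
    (H : sgraph U) (y : U) : Prop :=
  exists2 f : T -> U, is_giso G H f & f x = y.

Section Neighborhoods.
Variables (T : finType) (G : sgraph T).

Section Induced.
Variable A : {set T}.

Definition induced_edges : {set {set {x : T | x \in A}}} :=
  [set e : {set {x : T | x \in A}} | val @: e \in edges G].

Lemma induced_edgesP : edge_axiom induced_edges.
Proof.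
apply/forall_inP => e; rewrite inE => /(forall_inP (edgesP G)).
by rewrite card_imset //; exact: val_inj.
Qed.

Definition induced_subgraph : sgraph {x : T | x \in A} := SGraph induced_edgesP.

End Induced.

(* The graph distance from v to u is at most r iff some walk v :: p of length
   k <= r ends at u. *)
Definition dist_le (r : nat) (v u : T) : bool :=
  [exists k : 'I_r.+1, exists p : k.-tuple T, path (adj G) v p && (last v p == u)].

Definition gball (r : nat) (v : T) : {set T} := [set u | dist_le r v u].

Lemma gball_center (r : nat) (v : T) : v \in gball r v.
Proof.
by rewrite inE; apply/existsP; exists ord0; apply/existsP; exists [tuple] => /=.
Qed.

Definition nbhd_graph (r : nat) (v : T) : sgraph {x : T | x \in gball r v} :=
  induced_subgraph (gball r v).

Definition nbhd_root (r : nat) (v : T) : {x : T | x \in gball r v} :=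
  exist _ v (gball_center r v).

End Neighborhoods.

Definition same_nbhds (T : finType) (r : nat) (G H : sgraph T) : Prop :=
  forall v : T, rooted_isomorphic (nbhd_graph G r v) (nbhd_root G r v)
                                  (nbhd_graph H r v) (nbhd_root H r v).

Definition reconstructable (T : finType) (r : nat) (G : sgraph T) : Prop :=
  forall H : sgraph T, same_nbhds r G H -> isomorphic H G.

(* Point mass of G in G(n, p): independent Bernoulli(p) edges, one for each
   2-element subset of the vertex set. *)
Definition gnp_mass (R : realType) (n : nat) (p : R) (G : sgraph 'I_n) : R :=
  \prod_(e : {set 'I_n} | #|e| == 2%N) (if e \in edges G then p else 1 - p).

Definition gnp_prob (R : realType) (n : nat) (p : R)
    (P : sgraph 'I_n -> Prop) : R :=
  \sum_(G : sgraph 'I_n | `[< P G >]) gnp_mass p G.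

(* Main.v *)
Require Import Defs.
From HB Require Import structures.
From mathcomp Require Import all_boot all_order all_algebra all_fingroup.
From mathcomp Require Import all_classical all_reals all_analysis.
From mathcomp Require Import ring lra zify.

Set Implicit Arguments.
Unset Strict Implicit.
Unset Printing Implicit Defensive.

Import Order.TTheory GRing.Theory Num.Theory.
Import numFieldNormedType.Exports.

(** The proof compares the information carried by the 2-neighborhoods with the
    information carried by the graph. Let [d = n p = n ^ (1 - alpha)] be the mean
    degree, a positive power of [n] below [n ^ (1 / 4)].

    A graph with at least [c n d] edges has probability at most
    [p ^ (c n d) = exp (- alpha c n d ln n)]. On the other side, a ball of radius
    two is a breadth-first tree plus some extra edges. Up to isomorphism the tree
    is known once the numbers of children of the neighbours of the centre are
    known as a multiset; if all degrees are [O(d)] this leaves [exp (O(d))]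
    possibilities for each ball, hence [exp (O(n d))] for all of them, which is
    negligible. An extra edge costs [O(ln n)], but every extra edge lies on a
    cycle of length at most 5 of the ball, so that on average there are only
    [O(d ^ 5)] extra edges over all balls, and [d ^ 5 / (n d) = n ^ (3 - 4 alpha)]
    tends to 0 precisely because [alpha > 3 / 4]. So with high probability the
    extra edges are a small fraction of [n d] in number, and there are at most
    [exp (epsilon n d ln n)] systems of 2-neighborhoods to consider
    ([code_same_nbhds], [extra_triples_le], [expect_extra_triples]).

    Now the reconstructable graphs with given 2-neighborhoods are all isomorphic,
    hence at most [n`! <= exp (n ln n)] in number ([card_reconstructable]), which
    is negligible too as [d] tends to infinity. Altogether, typical
    reconstructable graphs are too few, and each of them too unlikely, for their
    total probability not to tend to 0 ([prob_reconstructable_le]).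

    This avoids exhibiting, for a given graph, another graph with the same
    2-neighborhoods and proving that the two are not isomorphic. The typical
    graphs are those with degrees [O(d)], [Omega(n d)] edges and few extra edges;
    the first two conditions follow from exponential moments, the last one from
    the mean number of extra edges. *)

(** * Balls of radius two: a breadth-first tree plus extra edges *)

Section TwoBall.
Variables (T : finType) (G : sgraph T).

Lemma adj_sym : symmetric (adj G).
Proof. by move=> x y; rewrite /adj finset.setUC. Qed.

Lemma adj_irr x : adj G x x = false.
Proof.
apply/negP => /(forall_inP (edgesP G)).
by rewrite finset.setUid cards1.
Qed.

Definition nbrs (v : T) : {set T} := [set u | adj G v u].

Definition sphere2 (v : T) : {set T} :=
  [set x | [&& x != v, ~~ adj G v x & [exists a, adj G v a && adj G a x]]].

Lemma gball2E v x :
  (x \in gball G 2 v) = [|| x == v, adj G v x | x \in sphere2 v].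
Proof.
rewrite !inE; apply/idP/idP.
  case/existsP => -[[|[|[|k]]] // hk] /existsP [p]; rewrite /=; move: p.
  - by move=> p; rewrite (tuple0 p) /= eq_sym => ->.
  - move=> p; case/tupleP: p => a p; rewrite (tuple0 p) /= andbT.
    by case/andP => va /eqP <-; rewrite va orbT.
  - move=> p; case/tupleP: p => a p; case/tupleP: p => b p.
    rewrite (tuple0 p) /= andbT => /andP [/andP [va ab]] /eqP <-.
    case: eqP => //= _; case: (adj G v b) => //=.
    by apply/existsP; exists a; rewrite va ab.
case/or3P => [/eqP -> | vx | /and3P [_ _ /existsP [a ax]]].
- by apply/existsP; exists ord0; apply/existsP; exists [tuple] => /=.
- apply/existsP; exists (@Ordinal 3 1 isT); apply/existsP; exists [tuple x].
  by rewrite /= vx eqxx.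
apply/existsP; exists (@Ordinal 3 2 isT); apply/existsP; exists [tuple a; x].
by rewrite /= eqxx !andbT.
Qed.

(** Fixing one neighbour of [v] adjacent to [x] turns the ball into a
    breadth-first tree; every other edge of the ball counts as extra. *)
Definition parent (v x : T) : T :=
  odflt v [pick a | adj G v a && adj G a x].

Lemma parentP v x : x \in sphere2 v ->
  adj G v (parent v x) && adj G (parent v x) x.
Proof.
rewrite inE /parent => /and3P [_ _ /existsP [a ax]].
by case: pickP => [//|/(_ a)]; rewrite ax.
Qed.

Definition children (v a : T) : {set T} :=
  [set x in sphere2 v | parent v x == a].

(** Listing the neighbours by increasing number of children makes the shape of
    the tree a multiset. With degrees at most [D] this leaves only
    ['C(2D, D) <= 4 ^ D] shapes; an unsorted list would leave about [D ^ D],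
    and the factor [log D] in the exponent would spoil the final count. *)
Definition sorted_nbrs (v : T) : seq T :=
  sort (relpre (fun a => #|children v a|) leq) (enum (nbrs v)).

Lemma mem_sorted_nbrs v a : (a \in sorted_nbrs v) = adj G v a.
Proof. by rewrite mem_sort mem_enum inE. Qed.

Lemma uniq_sorted_nbrs v : uniq (sorted_nbrs v).
Proof. by rewrite sort_uniq enum_uniq. Qed.

Lemma size_sorted_nbrs v : size (sorted_nbrs v) = #|nbrs v|.
Proof. by rewrite size_sort cardE. Qed.

Definition tree_parent (v x y : T) : bool :=
  (y == v) && adj G v x || (x \in sphere2 v) && (parent v x == y).

Definition extra_edge (v x y : T) : bool :=
  [&& x \in gball G 2 v, y \in gball G 2 v, adj G x y,
      ~~ tree_parent v x y & ~~ tree_parent v y x].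

(** Coordinates in the breadth-first tree. Indices are shifted by one, so that
    a zero first coordinate singles out the centre, and a zero second coordinate
    the vertices at distance at most one. *)
Definition pos (v x : T) : nat * nat :=
  if x == v then (0, 0)
  else if adj G v x then ((index x (sorted_nbrs v)).+1, 0)
  else ((index (parent v x) (sorted_nbrs v)).+1,
        (index x (enum (children v (parent v x)))).+1).

(** The tree edges, oriented towards the root and read off coordinates alone:
    this is what makes them recoverable from the shape. *)
Definition pos_parent (p q : nat * nat) : bool :=
  (p.2 != 0) && (q == (p.1, 0)) ||
  [&& p.1 != 0, p.2 == 0 & q == (0, 0)].

Lemma pos_center v : pos v v = (0, 0).
Proof. by rewrite /pos eqxx. Qed.

Lemma adj_neq v x : adj G v x -> x == v = false.
Proof. by move=> vx; apply/eqP => xv; rewrite xv adj_irr in vx. Qed.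

Lemma pos_nbr v x : adj G v x -> pos v x = ((index x (sorted_nbrs v)).+1, 0).
Proof. by move=> vx; rewrite /pos vx (adj_neq vx). Qed.

Lemma pos_sphere2 v x : x \in sphere2 v ->
  pos v x = ((index (parent v x) (sorted_nbrs v)).+1,
             (index x (enum (children v (parent v x)))).+1).
Proof.
by rewrite inE /pos => /and3P [/negbTE -> /negbTE -> _].
Qed.

Lemma mem_children v x : x \in sphere2 v ->
  x \in enum (children v (parent v x)).
Proof. by move=> vx; rewrite mem_enum inE vx eqxx. Qed.

Lemma index_sorted_nbrs_inj v a b : adj G v a -> adj G v b ->
  index a (sorted_nbrs v) = index b (sorted_nbrs v) -> a = b.
Proof.
rewrite -!mem_sorted_nbrs => va vb e.
by rewrite -(nth_index v va) -(nth_index v vb) e.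
Qed.

Lemma pos_inj v : {in gball G 2 v &, injective (pos v)}.
Proof.
move=> x y; rewrite !gball2E.
case/or3P => [/eqP -> | hx | hx]; case/or3P => [/eqP -> | hy | hy] //;
  rewrite ?pos_center ?(pos_nbr hx) ?(pos_nbr hy) ?(pos_sphere2 hx)
    ?(pos_sphere2 hy) //; case.
- exact: index_sorted_nbrs_inj.
- have /andP [ax _] := parentP hx; have /andP [ay _] := parentP hy.
  move/(index_sorted_nbrs_inj ax ay) => e; rewrite -e => e2.
  have cx := mem_children hx; have cy := mem_children hy.
  by rewrite -(nth_index v cx) e2 e nth_index.
Qed.

Lemma pos_parentE v x y : x \in gball G 2 v -> y \in gball G 2 v ->
  pos_parent (pos v x) (pos v y) = tree_parent v x y.
Proof.
move=> bx; have := bx; rewrite gball2E => hx by_.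
rewrite /tree_parent.
case/or3P: hx => [/eqP xv | hx | hx].
- rewrite xv pos_center /pos_parent /= adj_irr andbF /=.
  by rewrite inE eqxx.
- have -> : x \in sphere2 v = false by rewrite inE hx /= andbF.
  rewrite (pos_nbr hx) hx /pos_parent /= orbF andbT.
  rewrite -(pos_center v) (inj_in_eq (@pos_inj v)) //.
  by rewrite gball2E eqxx.
- have /andP [va _] := parentP hx.
  have -> : adj G v x = false by move: hx; rewrite inE => /and3P [_ /negbTE].
  rewrite andbF hx (pos_sphere2 hx) /pos_parent /= orbF -(pos_nbr va).
  rewrite (inj_in_eq (@pos_inj v)) // 1?eq_sym //.
  by rewrite gball2E va orbT.
Qed.

(** A missing neighbour is recorded as [D]. No neighbour [a] has that many
    children when degrees are at most [D], since [v] is a neighbour of [a] but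
    not a child of it; and [D] being the largest value, the list stays sorted. *)
Definition shape (D : nat) (v : T) (i : nat) : nat :=
  nth D [seq #|children v a| | a <- sorted_nbrs v] i.

(** The coordinates occupied by a ball of shape [s]. *)
Definition valid_pos (D : nat) (s : nat -> nat) (p : nat * nat) : bool :=
  if p.1 is i.+1 then (s i < D) && (p.2 <= s i) else p.2 == 0.

Section Bounded.
Variable D : nat.
Hypothesis degD : forall v, #|nbrs v| <= D.

Lemma card_children v a : adj G v a -> #|children v a| < D.
Proof.
move=> va; apply: leq_trans (degD a); apply: proper_card.
apply/properP; split; last first.
  exists v; first by rewrite inE adj_sym.
  by rewrite !inE eqxx.
apply/fintype.subsetP => x; rewrite [in X in X -> _]inE => /andP [hx /eqP e].
by have /andP [_] := parentP hx; rewrite e inE.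
Qed.

Lemma shape_nbr v a : adj G v a ->
  shape D v (index a (sorted_nbrs v)) = #|children v a|.
Proof.
rewrite -mem_sorted_nbrs /shape => va.
by rewrite (nth_map v) ?index_mem // nth_index.
Qed.

Lemma shape_le v i : shape D v i <= D.
Proof.
rewrite /shape; case: (ltnP i (size (sorted_nbrs v))) => hi.
  rewrite (nth_map v) //; apply/ltnW/card_children.
  by rewrite -mem_sorted_nbrs mem_nth.
by rewrite nth_default // size_map.
Qed.

Lemma shape_default v i : D <= i -> shape D v i = D.
Proof.
move=> Di; rewrite /shape nth_default // size_map size_sorted_nbrs.
exact: leq_trans (degD v) Di.
Qed.

Lemma shape_sorted v i j : i <= j -> shape D v i <= shape D v j.
Proof.
move=> ij; case: (ltnP j (size (sorted_nbrs v))) => hj; last first.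
  by rewrite [X in _ <= X]nth_default ?size_map // shape_le.
have srt : sorted leq [seq #|children v a| | a <- sorted_nbrs v].
  by rewrite sorted_map; apply: sort_sorted => a b; exact: leq_total.
rewrite /shape (sorted_leq_nth leq_trans leqnn D srt) ?inE ?size_map //.
exact: leq_ltn_trans ij hj.
Qed.

Lemma pos_valid v x : x \in gball G 2 v -> valid_pos D (shape D v) (pos v x).
Proof.
rewrite gball2E => /or3P [/eqP -> | hx | hx].
- by rewrite pos_center.
- by rewrite (pos_nbr hx) /valid_pos /= shape_nbr // card_children.
- have /andP [va _] := parentP hx.
  rewrite (pos_sphere2 hx) /valid_pos /= shape_nbr // card_children //=.
  by rewrite cardE index_mem mem_children.
Qed.

Lemma valid_posP v p : valid_pos D (shape D v) p ->
  exists2 x, x \in gball G 2 v & pos v x = p.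
Proof.
case: p => [[|i] j]; rewrite /valid_pos /=.
  by move/eqP ->; exists v; [rewrite gball2E eqxx | rewrite pos_center].
case/andP => hi hj.
have si : i < size (sorted_nbrs v).
  rewrite ltnNge; apply/negP => h.
  by move: hi; rewrite /shape nth_default ?size_map // ltnn.
have va : adj G v (nth v (sorted_nbrs v) i) by rewrite -mem_sorted_nbrs mem_nth.
set a := nth _ _ _ in va.
have ia : index a (sorted_nbrs v) = i by rewrite index_uniq ?uniq_sorted_nbrs.
case: j hj => [|j] hj.
  by exists a; [rewrite gball2E va orbT | rewrite pos_nbr // ia].
have sj : j < size (enum (children v a)) by rewrite -cardE -shape_nbr // ia.
have : nth v (enum (children v a)) j \in children v a.
  by rewrite -mem_enum mem_nth.
set x := nth _ _ _; rewrite inE => /andP [hx /eqP px].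
exists x; first by rewrite gball2E hx !orbT.
by rewrite (pos_sphere2 hx) px ia index_uniq // enum_uniq.
Qed.

Lemma pos_le v x : x \in gball G 2 v -> ((pos v x).1 <= D) && ((pos v x).2 <= D).
Proof.
move=> hx; have := pos_valid hx; rewrite /valid_pos.
case: (pos v x) => -[|i] j /=; first by move/eqP ->.
case/andP => hi hj; rewrite (leq_trans hj (ltnW hi)) andbT ltnNge.
by apply: contraTN hi => /(shape_default v) ->; rewrite ltnn.
Qed.

End Bounded.
End TwoBall.

Lemma adj_induced (T : finType) (G : sgraph T) (A : {set T})
  (x y : {x : T | x \in A}) :
  adj (induced_subgraph G A) x y = adj G (val x) (val y).
Proof. by rewrite /adj inE imsetU1 imset_set1. Qed.

(** Two balls drawn injectively in the same space, on the same points and with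
    the same edges, are isomorphic: compose one drawing with the inverse of the
    other. *)
Lemma rooted_isomorphic_placement (T : finType) (P : Type) (G H : sgraph T)
    (r : nat) (v : T) (f g : T -> P) :
  {in gball G r v &, injective f} -> {in gball H r v &, injective g} ->
  f v = g v ->
  (forall x, x \in gball G r v -> exists2 y, y \in gball H r v & g y = f x) ->
  (forall y, y \in gball H r v -> exists2 x, x \in gball G r v & f x = g y) ->
  (forall x x' y y', x \in gball G r v -> x' \in gball G r v ->
     y \in gball H r v -> y' \in gball H r v -> f x = g y -> f x' = g y' ->
     adj G x x' = adj H y y') ->
  rooted_isomorphic (nbhd_graph G r v) (nbhd_root G r v)
                    (nbhd_graph H r v) (nbhd_root H r v).
Proof.
move=> finj ginj fgv fg gf fadj.
have fg' (x : {x | x \in gball G r v}) :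
    exists y : {y | y \in gball H r v}, g (val y) = f (val x).
  by case: x => x hx; have [y hy e] := fg x hx; exists (Sub y hy).
have gf' (y : {y | y \in gball H r v}) :
    exists x : {x | x \in gball G r v}, f (val x) = g (val y).
  by case: y => y hy; have [x hx e] := gf y hy; exists (Sub x hx).
have [h hP] := boolp.choice fg'.
have [k kP] := boolp.choice gf'.
exists h; last first.
  apply/val_inj/ginj; [exact: valP | exact: gball_center | ].
  by rewrite hP /= -fgv.
split; last first.
  by move=> x y; rewrite !adj_induced; apply/esym/fadj; rewrite ?hP //; exact: valP.
exists k => x; apply/val_inj.
- apply: finj; last (by rewrite kP hP); exact: valP.
- apply: ginj; last (by rewrite hP kP); exact: valP.
Qed.

(** * Encoding the 2-neighborhoods *)

Section Code.
Variables (T : finType) (D : nat).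

(** Degrees at most [D] keep the coordinates in [0 .. D], hence in a type whose
    cardinality can be bounded. *)
Definition ipos (G : sgraph T) (v x : T) : 'I_D.+1 * 'I_D.+1 :=
  (inord (pos G v x).1, inord (pos G v x).2).

Definition shape_code (G : sgraph T) (v : T) : D.-tuple 'I_D.+1 :=
  [tuple inord (shape G D v i) | i < D].

Definition extra_triples (G : sgraph T) : {set T * T * T} :=
  [set t | extra_edge G t.1.1 t.1.2 t.2].

Definition extra_code (G : sgraph T) :
    {set T * (('I_D.+1 * 'I_D.+1) * ('I_D.+1 * 'I_D.+1))} :=
  [set (t.1.1, (ipos G t.1.1 t.1.2, ipos G t.1.1 t.2)) | t in extra_triples G].

Lemma ipos_inj (G : sgraph T) v x y : (forall v, #|nbrs G v| <= D) ->
  x \in gball G 2 v -> y \in gball G 2 v -> ipos G v x = ipos G v y -> x = y.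
Proof.
move=> degD hx hy [e1 e2]; apply: (pos_inj hx hy).
have /andP [x1 x2] := pos_le degD hx; have /andP [y1 y2] := pos_le degD hy.
move/(congr1 val): e1; move/(congr1 val): e2; rewrite /= !inordK //.
by case: (pos G v x) (pos G v y) => [? ?] [? ?] /= -> ->.
Qed.

Lemma mem_extra_code (G : sgraph T) v x y : (forall v, #|nbrs G v| <= D) ->
  x \in gball G 2 v -> y \in gball G 2 v ->
  ((v, (ipos G v x, ipos G v y)) \in extra_code G) = extra_edge G v x y.
Proof.
move=> degD hx hy; apply/imsetP/idP; last first.
  by move=> h; exists (v, x, y); rewrite ?inE.
case=> [[[w x'] y']]; rewrite inE /= => h [ev ex1 ex2 ey1 ey2].
move: h; rewrite -ev => h.
have /and5P [hx' hy' _ _ _] := h.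
have -> : x = x' by apply: (ipos_inj degD hx hx'); rewrite /ipos ex1 ex2 ev.
have -> : y = y' by apply: (ipos_inj degD hy hy'); rewrite /ipos ey1 ey2 ev.
by [].
Qed.

Lemma shape_codeE (G H : sgraph T) v :
  (forall v, #|nbrs G v| <= D) -> (forall v, #|nbrs H v| <= D) ->
  shape_code G v = shape_code H v -> shape G D v =1 shape H D v.
Proof.
move=> dG dH e i; case: (ltnP i D) => hi; last by rewrite !shape_default.
have := congr1 (fun t => val (tnth t (Ordinal hi))) e.
by rewrite !tnth_mktuple /= !inordK // ltnS shape_le.
Qed.

Lemma adj_tree_or_extra (G : sgraph T) v x y :
  x \in gball G 2 v -> y \in gball G 2 v ->
  adj G x y = [|| tree_parent G v x y, tree_parent G v y x | extra_edge G v x y].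
Proof.
move=> hx hy; have tp : forall a b, tree_parent G v a b -> adj G a b.
  move=> a b /orP [/andP [/eqP -> h] | /andP [h /eqP <-]].
    by rewrite adj_sym.
  by have /andP [_] := parentP h; rewrite adj_sym.
rewrite /extra_edge hx hy /=.
case e1 : (tree_parent G v x y); first by rewrite tp.
case e2 : (tree_parent G v y x); first by rewrite adj_sym tp.
by rewrite /= andbT.
Qed.

(** The shape of a ball determines both the coordinates that occur in it and
    its tree edges, and the extra code records its remaining edges. *)
Lemma code_same_nbhds (G H : sgraph T) :
  (forall v, #|nbrs G v| <= D) -> (forall v, #|nbrs H v| <= D) ->
  (forall v, shape_code G v = shape_code H v) ->
  extra_code G = extra_code H -> same_nbhds 2 G H.
Proof.
move=> dG dH es ee v.
have sh := shape_codeE dG dH (es v).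
have vp p : valid_pos D (shape G D v) p = valid_pos D (shape H D v) p.
  by case: p => [[|i] j]; rewrite /valid_pos //= sh.
apply: (@rooted_isomorphic_placement _ _ G H 2 v (pos G v) (pos H v)).
- exact: pos_inj.
- exact: pos_inj.
- by rewrite !pos_center.
- by move=> x /(pos_valid dG); rewrite vp => /valid_posP.
- by move=> y /(pos_valid dH); rewrite -vp => /valid_posP.
- move=> x x' y y' hx hx' hy hy' e e'.
  rewrite (adj_tree_or_extra hx hx') (adj_tree_or_extra hy hy').
  rewrite -!pos_parentE // e e'.
  rewrite -(mem_extra_code dG hx hx') -(mem_extra_code dH hy hy') ee.
  by rewrite /ipos e e'.
Qed.

Lemma shape_code_sorted (G : sgraph T) v : (forall v, #|nbrs G v| <= D) ->
  sorted leq [seq \val i | i <- shape_code G v].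
Proof.
move=> dG; apply/(sortedP 0) => i; rewrite size_map size_tuple => hi.
have hi' : i < D := ltnW hi.
rewrite !(nth_map ord0) ?size_tuple //.
rewrite -[i]/(val (Ordinal hi')) -[X in _ <= \val (nth _ _ X)]/(val (Ordinal hi)).
rewrite -!tnth_nth !tnth_mktuple /= !inordK ?ltnS ?shape_le //.
exact: shape_sorted.
Qed.

Lemma card_extra_code (G : sgraph T) : #|extra_code G| <= #|extra_triples G|.
Proof. exact: leq_imset_card. Qed.

End Code.

(** * Reconstructable graphs are few *)

(** A set of at most [L] elements is listed by an [L]-tuple padded with
    [None]. *)
Lemma card_small_sets (Y : finType) (L : nat) :
  #|[set X : {set Y} | #|X| <= L]| <= #|Y|.+1 ^ L.
Proof.
rewrite -card_option -card_tuple.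
pose h (t : L.-tuple (option Y)) := [set y | Some y \in t].
apply: leq_trans (leq_imset_card h predT).
apply/subset_leq_card/fintype.subsetP => X; rewrite inE => XL.
have st : size (map Some (enum X) ++ nseq (L - #|X|) None) == L.
  by rewrite size_cat size_map size_nseq -cardE subnKC.
apply/imsetP; exists (Tuple st) => //; apply/setP => y.
rewrite inE memtE /= mem_cat mem_map ?mem_enum; last exact: Some_inj.
by rewrite mem_nseq andbF orbF.
Qed.

Lemma card_fibres (A C : finType) (S : {set A}) (K : {set C}) (f : A -> C) m :
  (forall x, x \in S -> f x \in K) ->
  (forall c, c \in K -> #|[set x in S | f x == c]| <= m) -> #|S| <= #|K| * m.
Proof.
move=> fK fm; rewrite -sum1_card (partition_big f (mem K)) //=.
rewrite -sum_nat_const; apply: leq_sum => c cK.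
by rewrite sum1_card; move: (fm c cK); rewrite cardsE.
Qed.

Lemma sgraph_eq (T : finType) (G H : sgraph T) : adj G =2 adj H -> G = H.
Proof.
move=> e; apply/val_inj/setP => /= s; case: (boolP (#|s| == 2)) => [|n2].
  by case/cards2P => x [y [_ ->]]; exact: e.
have h (K : sgraph T) : (s \in edges K) = false.
  by apply: contraNF n2; apply: (forall_inP (edgesP K)).
by rewrite !h.
Qed.

(** All these graphs are relabelings of any one of them, and the permutation
    used for relabeling determines the graph. *)
Lemma card_isomorphic (T : finType) (S : {set sgraph T}) :
  (forall G H, G \in S -> H \in S -> isomorphic H G) -> #|S| <= (#|T|)`!.
Proof.
move=> iso; case: (set_0Vmem S) => [-> | [G GS]]; first by rewrite cards0.
have perm_iso H : H \in S ->
    exists s : {perm T}, forall x y, adj G (s x) (s y) = adj H x y.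
  move=> HS; have [f [/bij_inj finj fadj]] := iso _ _ GS HS.
  by exists (perm finj) => x y; rewrite !permE.
pose h (s : {perm T}) : option (sgraph T) :=
  [pick H in S | [forall x, forall y, adj G (s x) (s y) == adj H x y]].
have -> : (#|T|)`! = #|{perm T}|.
  rewrite -(cardsT T) -card_perm; apply: eq_card => s.
  by rewrite [RHS]inE unfold_in; apply/fintype.subsetP => x _; rewrite inE.
have someI : injective (fun H : sgraph T => Some H) by move=> ? ? [].
rewrite -(card_imset _ someI).
apply: leq_trans (leq_imset_card h predT).
apply/subset_leq_card/fintype.subsetP => o /imsetP [H HS ->].
have [s sP] := perm_iso _ HS; apply/imsetP; exists s => //.
rewrite /h; case: pickP => [K /andP [_ /forallP sK] | /(_ H)].
  congr Some; apply: sgraph_eq => x y; rewrite -sP.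
  by apply/eqP; have /forallP := sK x.
rewrite HS /= => /negP []; apply/forallP => x; apply/forallP => y.
by rewrite sP.
Qed.

(** Reconstructable graphs with the same code have the same 2-neighborhoods,
    hence are isomorphic: each code accounts for at most [n`!] of them, and
    bounded degrees with few extra edges leave few codes. *)
Lemma card_reconstructable (T : finType) (D L : nat) (S : {set sgraph T}) :
  (forall G, G \in S -> [/\ reconstructable 2 G,
      forall v, #|nbrs G v| <= D & #|extra_triples G| <= L]) ->
  #|S| <= 'C(D + D, D) ^ #|T| * (#|T| * D.+1 ^ 4).+1 ^ L * (#|T|)`!.
Proof.
move=> hS.
pose code (G : sgraph T) :=
  ([ffun v => shape_code D G v], extra_code D G).
pose shapes := [set t : D.-tuple 'I_D.+1 | sorted leq [seq \val i | i <- t]].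
pose K := finset.setX [set f : {ffun T -> D.-tuple 'I_D.+1} | f \in ffun_on shapes]
  [set X : {set T * (('I_D.+1 * 'I_D.+1) * ('I_D.+1 * 'I_D.+1))} | #|X| <= L].
apply: leq_trans (_ : #|K| * (#|T|)`! <= _).
  apply: (@card_fibres _ _ _ _ code).
    move=> G /hS [_ dG eG]; rewrite !inE /= (leq_trans (card_extra_code _ _) eG).
    rewrite andbT; apply/ffun_onP => v; rewrite ffunE inE.
    exact: shape_code_sorted.
  move=> c _; apply: card_isomorphic => G H.
  rewrite !inE => /andP [/hS [rG dG _] /eqP eG] /andP [/hS [_ dH _] /eqP eH].
  apply: rG; move: eH; rewrite -eG => -[e1 e2].
  apply: code_same_nbhds dG dH _ (esym e2) => v.
  by move/ffunP: e1 => /(_ v); rewrite !ffunE.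
rewrite leq_mul2r; apply/orP; right; rewrite cardsX; apply: leq_mul.
  by rewrite cardsE card_ffun_on card_sorted_tuples.
apply: leq_trans (card_small_sets _ _) _.
by rewrite !card_prod !card_ord !expnS expn0 muln1 !mulnA.
Qed.

(** * Extra edges and short cycles *)

(** Patterns on the vertices [0 .. k] are lists of pairs of numbers, so that
    their side conditions are decided by computation. *)
Definition image_edges (T : finType) (k : nat) (s : seq (nat * nat))
    (t : k.+1.-tuple T) : seq {set T} :=
  [seq [set nth (thead t) t q.1; nth (thead t) t q.2] | q <- s].

Definition copies (T : finType) (G : sgraph T) (k : nat)
    (s : seq (nat * nat)) : {set k.+1.-tuple T} :=
  [set t : k.+1.-tuple T | uniq t && all [in edges G] (image_edges s t)].

Lemma uniq_image_edges (T : finType) k s (t : k.+1.-tuple T) :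
  all (fun q => q.1 < q.2 < k.+1) s -> uniq s -> uniq t ->
  uniq (image_edges s t).
Proof.
move=> /allP sk us ut; rewrite map_inj_in_uniq // => -[i j] [i' j'].
move=> /sk /= /andP [ij jk] /sk /= /andP [ij' jk'] e.
have ik := ltn_trans ij jk; have ik' := ltn_trans ij' jk'.
have mem a b c : a < k.+1 -> b < k.+1 -> c < k.+1 ->
    (nth (thead t) t a \in [set nth (thead t) t b; nth (thead t) t c])
    = (a == b) || (a == c).
  by move=> *; rewrite !inE !nth_uniq ?size_tuple.
have := set21 (nth (thead t) t i) (nth (thead t) t j); rewrite e mem //.
have := set22 (nth (thead t) t i) (nth (thead t) t j); rewrite e mem //.
have := set21 (nth (thead t) t i') (nth (thead t) t j'); rewrite -e mem //.
have := set22 (nth (thead t) t i') (nth (thead t) t j'); rewrite -e mem //.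
case/orP => /eqP ?; case/orP => /eqP ?; case/orP => /eqP ?; case/orP => /eqP ?;
  subst => //; by rewrite ?ltnn // in ij ij'; have := ltn_trans ij ij'; rewrite ltnn.
Qed.

Definition triangle_edges : seq (nat * nat) := [:: (0, 1); (1, 2); (0, 2)].
Definition square_edges : seq (nat * nat) := [:: (0, 1); (1, 2); (2, 3); (0, 3)].
(** A triangle on the vertices 1, 2, 3 with a pendant edge to the vertex 0. *)
Definition paw_edges : seq (nat * nat) := [:: (0, 1); (1, 2); (2, 3); (1, 3)].
Definition pentagon_edges : seq (nat * nat) :=
  [:: (0, 1); (1, 2); (2, 3); (3, 4); (0, 4)].

(** An extra edge closes a cycle with the tree paths joining its ends to [v].
    Its length is 3, 4 or 5 according to the distances of the ends to [v], except
    that two ends with the same parent form a triangle with this parent, which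
    the path to [v] extends to a paw. All four patterns have as many edges as
    vertices, so that a pattern on [k] vertices has about [(n p) ^ k] copies on
    average. *)
Lemma extra_triples_le (T : finType) (G : sgraph T) :
  #|extra_triples G| <= #|copies G 2 triangle_edges|
    + #|copies G 3 square_edges| + #|copies G 3 square_edges|
    + #|copies G 3 paw_edges| + #|copies G 4 pentagon_edges|.
Proof.
pose f3 (t : 3.-tuple T) := (tnth t (inord 0), tnth t (inord 1), tnth t (inord 2)).
pose f4 (t : 4.-tuple T) := (tnth t (inord 0), tnth t (inord 1), tnth t (inord 2)).
pose f4' (t : 4.-tuple T) := (tnth t (inord 0), tnth t (inord 2), tnth t (inord 1)).
pose fp (t : 4.-tuple T) := (tnth t (inord 0), tnth t (inord 2), tnth t (inord 3)).
pose f5 (t : 5.-tuple T) := (tnth t (inord 0), tnth t (inord 2), tnth t (inord 3)).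
apply: leq_trans (_ : #|(f3 @: copies G 2 triangle_edges)
    :|: (f4 @: copies G 3 square_edges) :|: (f4' @: copies G 3 square_edges)
    :|: (fp @: copies G 3 paw_edges) :|: (f5 @: copies G 4 pentagon_edges)| <= _);
  last first.
  do 4! (apply: leq_trans (leq_card_setU _ _) _;
         apply: leq_add; last exact: leq_imset_card).
  exact: leq_imset_card.
apply/subset_leq_card/fintype.subsetP => -[[v x] y]; rewrite !inE /=.
case/and5P; rewrite !gball2E => hx hy xy nt nt'.
have far z : z \in sphere2 G v -> (v == z = false) * (adj G v z = false).
  by rewrite inE eq_sym => /and3P [/negbTE -> /negbTE -> _].
have near z : adj G v z -> (v == z) = false.
  by rewrite eq_sym => /adj_neq ->.
have ne a b : adj G a b -> (a == b) = false.
  by move=> ab; apply/eqP => e; rewrite e adj_irr in ab.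
have ne2 a b : adj G v a -> b \in sphere2 G v -> (a == b) = false.
  by move=> va /far [_ vb]; apply/eqP => e; rewrite -e va in vb.
have yx : adj G y x by rewrite adj_sym.
case/or3P: hx => [/eqP xv|hx|hx].
- exfalso; subst x.
  by move: nt'; rewrite /tree_parent eqxx xy.
- case/or3P: hy => [/eqP yv|hy|hy].
  + exfalso; subst y.
    by move: nt; rewrite /tree_parent eqxx hx.
  + do 4! (apply/orP; left).
    apply/imsetP; exists [tuple v; x; y]; last by rewrite /f3 !(tnth_nth v) !inordK.
    rewrite inE /image_edges /= !inE !negb_or !near // ne // /=.
    by apply/and4P; split.
  + have /andP [va ay] := parentP hy.
    have ax : (x == parent G v y) = false.
      apply/eqP => e; move: nt'.
      by rewrite /tree_parent hy -e eqxx orbT.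
    do 3! (apply/orP; left); apply/orP; right.
    apply/imsetP; exists [tuple v; x; y; parent G v y];
      last by rewrite /f4 !(tnth_nth v) !inordK.
    rewrite inE /image_edges /= !inE !negb_or (near _ hx) (near _ va) (far _ hy).
    rewrite (ne2 _ _ hx hy) ax [y == _]eq_sym (ne2 _ _ va hy) /=.
    by apply/and5P; split=> //; rewrite -/(adj G _ _) adj_sym.
- case/or3P: hy => [/eqP yv|hy|hy].
  + by exfalso; subst y; have := far _ hx; rewrite adj_sym xy => -[].
  + have /andP [va ax] := parentP hx.
    have ay : (y == parent G v x) = false.
      apply/eqP => e; move: nt.
      by rewrite /tree_parent hx -e eqxx orbT.
    do 2! (apply/orP; left); apply/orP; right.
    apply/imsetP; exists [tuple v; y; x; parent G v x];
      last by rewrite /f4' !(tnth_nth v) !inordK.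
    rewrite inE /image_edges /= !inE !negb_or (near _ hy) (near _ va) (far _ hx).
    rewrite (ne2 _ _ hy hx) ay [x == _]eq_sym (ne2 _ _ va hx) /=.
    by apply/and5P; split=> //; rewrite -/(adj G _ _) adj_sym.
  + have /andP [va ax] := parentP hx; have /andP [vb b_y] := parentP hy.
    case: (eqVneq (parent G v x) (parent G v y)) => [e|ab].
      apply/orP; left; apply/orP; right.
      apply/imsetP; exists [tuple v; parent G v x; x; y];
        last by rewrite /fp !(tnth_nth v) !inordK.
      rewrite inE /image_edges /= !inE !negb_or (near _ va) (far _ hx) (far _ hy).
      rewrite (ne2 _ _ va hx) (ne2 _ _ va hy) ne //=.
      by apply/and5P; split=> //; rewrite e.
    apply/orP; right.
    apply/imsetP; exists [tuple v; parent G v x; x; y; parent G v y];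
      last by rewrite /f5 !(tnth_nth v) !inordK.
    rewrite inE /image_edges /= !inE !negb_or (near _ va) (far _ hx) (far _ hy).
    rewrite (near _ vb) (ne2 _ _ va hx) (ne2 _ _ va hy) ab [x == parent _ _ _]eq_sym.
    rewrite [y == parent _ _ _]eq_sym (ne2 _ _ vb hx) (ne2 _ _ vb hy) ne //=.
    apply/and5P; split=> //; first by rewrite -/(adj G _ _) adj_sym.
    by rewrite andbT.
Qed.

(** * Moments in the random graph *)

Local Open Scope ring_scope.

Section RandomGraph.
Variables (R : realType) (n : nat).
Implicit Types (G : sgraph 'I_n) (e : {set 'I_n}).

(** Expanding the product over pairs chooses [a] or [b] for every pair, and the
    pairs where [a] is chosen form the edge set of a graph. Hence the
    independence of the edges. *)
Lemma sum_sgraph_prod (a b : {set 'I_n} -> R) :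
  \sum_(G : sgraph 'I_n) \prod_(e : {set 'I_n} | #|e| == 2%N)
     (if e \in edges G then a e else b e)
  = \prod_(e : {set 'I_n} | #|e| == 2%N) (a e + b e).
Proof.
(* On sets that are not pairs, weights 0 and 1 forbid being an edge. *)
pose a' e := if #|e| == 2%N then a e else 0.
pose b' e := if #|e| == 2%N then b e else 1.
have -> : \prod_(e : {set 'I_n} | #|e| == 2%N) (a e + b e)
    = \prod_e (a' e + b' e).
  rewrite [RHS](bigID (fun e => #|e| == 2%N)) /= [X in _ = _ * X]big1 ?mulr1.
    by apply: eq_bigr => e h; rewrite /a' /b' h.
  by move=> e /negbTE h; rewrite /a' /b' h add0r.
rewrite bigA_distr [RHS](bigID (fun E => edge_axiom E)) /=.
rewrite [X in _ = _ + X]big1 ?addr0; last first.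
  move=> E; rewrite negb_forall_in => /exists_inP [e eE ne].
  by rewrite (bigD1 e) //= eE /a' (negbTE ne) mul0r.
rewrite (reindex_omap (@edges 'I_n) insub) /=; last first.
  by move=> E EE; rewrite insubT.
apply: eq_big => [G | G _].
  by rewrite edgesP valK eqxx.
rewrite [RHS](bigID (fun e => #|e| == 2%N)) /= [X in _ = _ * X]big1 ?mulr1.
  by apply: eq_bigr => e h; rewrite /a' /b' h.
move=> e h; rewrite /a' /b' (negbTE h); case: ifP => // eG.
by case/negP: h; apply: (forall_inP (edgesP G)).
Qed.

Variable p : R.

Lemma expect_prod (g h : {set 'I_n} -> R) :
  \sum_(G : sgraph 'I_n) gnp_mass p G *
     \prod_(e : {set 'I_n} | #|e| == 2%N) (if e \in edges G then g e else h e)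
  = \prod_(e : {set 'I_n} | #|e| == 2%N) (p * g e + (1 - p) * h e).
Proof.
rewrite -sum_sgraph_prod; apply: eq_bigr => G _; rewrite /gnp_mass -big_split.
by apply: eq_bigr => e _ /=; case: ifP.
Qed.

Lemma sum_gnp_mass : \sum_(G : sgraph 'I_n) gnp_mass p G = 1.
Proof.
rewrite (sum_sgraph_prod (fun=> p) (fun=> 1 - p)) big1 // => e _.
by rewrite addrC subrK.
Qed.

Lemma gnp_prob_compl (P : sgraph 'I_n -> Prop) :
  gnp_prob p (fun G => ~ P G) = 1 - gnp_prob p P.
Proof.
rewrite -sum_gnp_mass [in X in X - _](bigID (fun G => `[< P G >])) /=.
rewrite -/(gnp_prob p P).
rewrite addrAC subrr add0r /gnp_prob; apply: eq_bigl => G.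
by rewrite asbool_neg.
Qed.

Lemma prob_edges (s : seq {set 'I_n}) : uniq s -> all (fun e => #|e| == 2%N) s ->
  \sum_(G : sgraph 'I_n | all [in edges G] s) gnp_mass p G = p ^+ size s.
Proof.
move=> us s2.
transitivity (\sum_(G : sgraph 'I_n) gnp_mass p G *
     \prod_(e : {set 'I_n} | #|e| == 2%N)
        (if e \in edges G then 1 else if e \in s then 0 else 1)).
  rewrite [LHS]big_mkcond; apply: eq_bigr => G _; case: allP => sG.
    rewrite big1 ?mulr1 // => e _; case: ifP => // eG.
    by case: ifP => // /sG; rewrite eG.
  suff : exists2 e, e \in s & e \notin edges G.
    case=> e es /negbTE eG; rewrite (bigD1 e) ?(allP s2) //= eG es.
    by rewrite mul0r mulr0.
  apply: contrapT => hn; apply: sG => e es; apply: contrapT => /negP eG.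
  by apply: hn; exists e.
rewrite (expect_prod (fun=> 1) (fun e => if e \in s then 0 else 1)) /=.
rewrite (bigID (fun e => e \in s)) /= [X in _ * X]big1 ?mulr1; last first.
  by move=> e /andP [_ /negbTE ->]; rewrite !mulr1 addrC subrK.
rewrite (eq_bigr (fun=> p)); last first.
  by move=> e /andP [_ ->]; rewrite mulr0 addr0.
rewrite prodr_const; congr (_ ^+ _).
rewrite -(card_uniqP us); apply: eq_card => e.
rewrite unfold_in; apply/andP/idP => [[]//|es]; split=> //; exact: (allP s2).
Qed.

Hypothesis p01 : 0 <= p <= 1.

Lemma gnp_mass_ge0 G : 0 <= gnp_mass p G.
Proof.
case/andP: p01 => p0 p1; apply: prodr_ge0 => e _.
by case: ifP; rewrite ?subr_ge0.
Qed.

Lemma gnp_prob_ge0 P : 0 <= @gnp_prob R n p P.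
Proof. by apply: sumr_ge0 => G _; exact: gnp_mass_ge0. Qed.

Lemma gnp_prob_le_expect (P : sgraph 'I_n -> Prop) (f : sgraph 'I_n -> R) :
  (forall G, 0 <= f G) -> (forall G, P G -> 1 <= f G) ->
  gnp_prob p P <= \sum_(G : sgraph 'I_n) gnp_mass p G * f G.
Proof.
move=> f0 f1; rewrite /gnp_prob big_mkcond /=; apply: ler_sum => G _.
case: asboolP => [/f1 h|_]; last by rewrite mulr_ge0 ?gnp_mass_ge0.
by rewrite ler_peMr ?gnp_mass_ge0.
Qed.

Lemma gnp_mass_le G : gnp_mass p G <= p ^+ #|edges G|.
Proof.
case/andP: p01 => p0 p1.
rewrite /gnp_mass (bigID (fun e => e \in edges G)) /=.
rewrite (eq_bigr (fun=> p)); last by move=> e /andP [_ ->].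
rewrite (eq_bigl [in edges G]); last first.
  by move=> e; rewrite andb_idl // => /(forall_inP (edgesP G)).
rewrite prodr_const ler_piMr ?exprn_ge0 //.
apply: numdomain.Num.Theory.prodr_ile1 => e /andP [_ /negbTE ->].
by rewrite subr_ge0 p1 gerBl.
Qed.

Lemma expect_copies k s :
  all (fun q => (q.1 < q.2 < k.+1)%N) s -> uniq s ->
  \sum_(G : sgraph 'I_n) gnp_mass p G * #|copies G k s|%:R
  <= n%:R ^+ k.+1 * p ^+ size s.
Proof.
case/andP: p01 => p0 p1 sk us.
have -> : \sum_(G : sgraph 'I_n) gnp_mass p G * #|copies G k s|%:R
  = \sum_(t : k.+1.-tuple 'I_n | uniq t)
      \sum_(G : sgraph 'I_n | all [in edges G] (image_edges s t)) gnp_mass p G.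
  under [RHS]eq_bigr do rewrite big_mkcond.
  rewrite exchange_big /=; apply: eq_bigr => G _.
  rewrite -big_mkcondr /= sumr_const -[RHS]mulr_natr; congr (_ * _%:R).
  by apply: eq_card => t; rewrite inE.
rewrite (eq_bigr (fun=> p ^+ size s)); last first.
  move=> t ut; rewrite prob_edges ?uniq_image_edges ?size_map //.
  apply/allP => e /mapP [[i j] /(allP sk) /= /andP [ij jk] ->].
  by rewrite cards2 nth_uniq ?size_tuple // ?(ltn_trans ij jk) // (ltn_eqF ij).
rewrite sumr_const -[leLHS]mulr_natl ler_wpM2r ?exprn_ge0 // -natrX ler_nat.
by apply: leq_trans (max_card _) _; rewrite card_tuple card_ord.
Qed.

(** The pentagon dominates as soon as the mean degree is at least 1. *)
Lemma expect_extra_triples : 1 <= n%:R * p ->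
  \sum_(G : sgraph 'I_n) gnp_mass p G * #|extra_triples G|%:R
  <= 5%:R * (n%:R * p) ^+ 5.
Proof.
move=> np1; case/andP: (p01) => p0 p1.
have h3 := @expect_copies 2 triangle_edges isT isT.
have h4 := @expect_copies 3 square_edges isT isT.
have hp := @expect_copies 3 paw_edges isT isT.
have h5 := @expect_copies 4 pentagon_edges isT isT.
rewrite -!exprMn /= in h3 h4 hp h5.
have le35 : (n%:R * p) ^+ 3 <= (n%:R * p) ^+ 5 by rewrite ler_weXn2l.
have le45 : (n%:R * p) ^+ 4 <= (n%:R * p) ^+ 5 by rewrite ler_weXn2l.
apply: (@le_trans _ _ (\sum_(G : sgraph 'I_n) gnp_mass p G *
   (#|copies G 2 triangle_edges|%:R
    + #|copies G 3 square_edges|%:R + #|copies G 3 square_edges|%:R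
    + #|copies G 3 paw_edges|%:R + #|copies G 4 pentagon_edges|%:R))).
  apply: ler_sum => G _; rewrite ler_wpM2l ?gnp_mass_ge0 // -!natrD ler_nat.
  exact: extra_triples_le.
under eq_bigr do rewrite !mulrDr.
rewrite !big_split /=.
move: h3 h4 hp h5 le35 le45; move: (_ ^+ 3) (_ ^+ 4) (_ ^+ 5) => a b c.
move: (\sum_i _) (\sum_i _) (\sum_i _) (\sum_i _) => x y z w.
lra.
Qed.

(** An exponential moment, for the upper tail of the degrees; only the factors
    of the at most [n] pairs containing [v] differ from 1. *)
Lemma expect_deg (v : 'I_n) :
  \sum_(G : sgraph 'I_n) gnp_mass p G * 2%:R ^+ #|nbrs G v|
  <= (1 + p) ^+ n.
Proof.
case/andP: (p01) => p0 p1.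
pose I := [set e : {set 'I_n} | (#|e| == 2%N) && (v \in e)].
have cI : (#|I| <= n)%N.
  apply: leq_trans (_ : #|[set [set v; u] | u in 'I_n]| <= _)%N; last first.
    by apply: leq_trans (leq_imset_card _ _) _; rewrite card_ord.
  apply/subset_leq_card/fintype.subsetP => e; rewrite inE => /andP [].
  case/cards2P => x [y [_ ->]]; rewrite !inE => /orP [] /eqP ->.
    by apply/imsetP; exists y.
  by apply/imsetP; exists x; rewrite // finset.setUC.
apply: (@le_trans _ _ (\sum_(G : sgraph 'I_n) gnp_mass p G *
     \prod_(e : {set 'I_n} | #|e| == 2%N)
        (if e \in edges G then (if v \in e then 2%:R else 1) else 1))).
  apply: ler_sum => G _; rewrite ler_wpM2l ?gnp_mass_ge0 //.
  rewrite (bigID (fun e => (e \in edges G) && (v \in e))) /=.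
  rewrite [X in _ * X]big1 ?mulr1; last first.
    by move=> e /andP [_]; case: ifP => //= _ /negbTE ->.
  rewrite (eq_bigr (fun=> 2%:R)); last by move=> e /and3P [_ -> ->].
  rewrite prodr_const ler_weXn2l ?ler1n //.
  have inj : {in nbrs G v &, injective (fun u => [set v; u])}.
    move=> x y; rewrite !inE => vx vy e.
    have := set22 v x; rewrite e !inE => /orP [/eqP xv|/eqP //].
    by rewrite xv adj_irr in vx.
  rewrite -(card_in_imset inj).
  apply/subset_leq_card/fintype.subsetP => e /imsetP [u]; rewrite inE => vu ->.
  rewrite unfold_in set21 andbT -/(adj G v u) vu andbT.
  exact: (forall_inP (edgesP G)).
rewrite expect_prod.
rewrite (bigID (fun e => v \in e)) /= [X in _ * X]big1 ?mulr1; last first.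
  by move=> e /andP [_ /negbTE ->]; rewrite !mulr1 addrC subrK.
rewrite (eq_bigr (fun=> 1 + p)); last first.
  by move=> e /andP [_ ->]; ring.
rewrite prodr_const; apply: ler_weXn2l; first by rewrite lerDl.
by apply: leq_trans cI; rewrite -[X in (_ <= X)%N]cardsE; apply: eq_leq;
   apply: eq_card => e; rewrite !inE.
Qed.

(** An exponential moment with base less than 1, for the lower tail of the
    number of edges. *)
Lemma expect_edges :
  \sum_(G : sgraph 'I_n) gnp_mass p G * (2%:R^-1) ^+ #|edges G|
  = (1 - p / 2%:R) ^+ 'C(n, 2).
Proof.
transitivity (\sum_(G : sgraph 'I_n) gnp_mass p G *
     \prod_(e : {set 'I_n} | #|e| == 2%N)
        (if e \in edges G then 2%:R^-1 else 1)).
  apply: eq_bigr => G _; congr (_ * _).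
  rewrite -big_mkcondr /= prodr_const; congr (_ ^+ _); apply: eq_card => e.
  rewrite unfold_in; apply/idP/andP => [eG|[]//]; split=> //.
  exact: (forall_inP (edgesP G)).
rewrite expect_prod prodr_const; congr (_ ^+ _); first by field.
by rewrite -[in RHS](card_ord n) -card_draws cardsE.
Qed.

(** The first three terms are Markov bounds for a vertex of degree more than
    [D], fewer than [M] edges and more than [L] extra triples. Outside these
    events a reconstructable graph has one of the codes counted above, and its
    probability is at most [p ^+ M]. *)
Lemma prob_reconstructable_le (D L M : nat) : 1 <= n%:R * p ->
  gnp_prob p (fun G : sgraph 'I_n => reconstructable 2 G)
  <= n%:R * (2%:R^-1 ^+ D * (1 + p) ^+ n)
   + 2%:R ^+ M * (1 - p / 2%:R) ^+ 'C(n, 2)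
   + 5%:R * (n%:R * p) ^+ 5 / L.+1%:R
   + ('C(D + D, D) ^ n * (n * D.+1 ^ 4).+1 ^ L * n`!)%:R * p ^+ M.
Proof.
move=> np1; case/andP: (p01) => p0 p1.
pose typical G := [&& [forall v, #|nbrs G v| <= D]%N, (#|extra_triples G| <= L)%N,
  (M <= #|edges G|)%N & `[< reconstructable 2 G >]].
pose f G : R := \sum_v (2%:R^-1 ^+ D * 2%:R ^+ #|nbrs G v|)
  + 2%:R ^+ M * 2%:R^-1 ^+ #|edges G|
  + #|extra_triples G|%:R / L.+1%:R + (typical G)%:R.
have a0 G : 0 <= \sum_v (2%:R^-1 ^+ D * 2%:R ^+ #|nbrs G v|) :> R.
  by apply: sumr_ge0 => v _; rewrite mulr_ge0 ?exprn_ge0 ?invr_ge0.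
have b0 G : 0 <= 2%:R ^+ M * 2%:R^-1 ^+ #|edges G| :> R.
  by rewrite mulr_ge0 ?exprn_ge0 ?invr_ge0.
have c0 G : 0 <= #|extra_triples G|%:R / L.+1%:R :> R by rewrite divr_ge0.
have d0 G : 0 <= (typical G)%:R :> R by [].
have f0 G : 0 <= f G by rewrite /f !addr_ge0.
apply: le_trans (gnp_prob_le_expect f0 _) _ => [G rG|].
  have := d0 G; have := a0 G; have := b0 G; have := c0 G; rewrite /f.
  case tG : (typical G); first by move=> *; rewrite lerDr ?addr_ge0.
  move: tG; rewrite /typical asboolT // andbT => /negbT; rewrite !negb_and.
  case/or3P; rewrite -?ltnNge => h hc hb ha _; rewrite addr0.
  - case/forallPn: h => v; rewrite -ltnNge => h.
    rewrite -addrA ler_wpDr ?addr_ge0 // (bigD1 v) //= ler_wpDr //.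
      by apply: sumr_ge0 => u _; rewrite mulr_ge0 ?exprn_ge0 ?invr_ge0.
    rewrite exprVn mulrC ler_pdivlMr ?exprn_gt0 // mul1r.
    by rewrite ler_weXn2l ?ler1n // ltnW.
  - by rewrite ler_wpDl ?addr_ge0 // ler_pdivlMr // mul1r ler_nat.
  - rewrite addrAC ler_wpDl ?addr_ge0 // exprVn ler_pdivlMr ?exprn_gt0 // mul1r.
    by rewrite ler_weXn2l ?ler1n // ltnW.
rewrite /f; under eq_bigr do rewrite !mulrDr; rewrite !big_split /=.
apply: lerD; first apply: lerD; first apply: lerD.
- under eq_bigr do rewrite mulr_sumr; rewrite exchange_big /=.
  rewrite -[in leRHS](card_ord n) mulr_natl -sumr_const; apply: ler_sum => v _.
  under eq_bigr do rewrite mulrCA; rewrite -mulr_sumr card_ord.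
  by rewrite ler_wpM2l ?exprn_ge0 ?invr_ge0 // expect_deg.
- by under eq_bigr do rewrite mulrCA; rewrite -mulr_sumr expect_edges.
- under eq_bigr do rewrite mulrA; rewrite -mulr_suml.
  by rewrite ler_wpM2r ?invr_ge0 // expect_extra_triples.
- have -> : \sum_G gnp_mass p G * (typical G)%:R = \sum_(G | typical G) gnp_mass p G.
    rewrite [RHS]big_mkcond; apply: eq_bigr => G _.
    by case: (typical G); rewrite ?mulr1 ?mulr0.
  apply: (@le_trans _ _ (\sum_(G | typical G) p ^+ M)).
    apply: ler_sum => G /and4P [_ _ mG _]; apply: le_trans (gnp_mass_le G) _.
    exact: ler_wiXn2l.
  rewrite sumr_const -[leLHS]mulr_natl ler_wpM2r ?exprn_ge0 // ler_nat.
  have := @card_reconstructable _ D L [set G | typical G].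
  rewrite card_ord cardsE; apply => G.
  rewrite inE => /and4P [/forallP h1 h2 _ /asboolP].
  by [].
Qed.

End RandomGraph.

(** * Asymptotics *)

Lemma bin_le_exp2 (m k : nat) : ('C(m, k) <= 2 ^ m)%N.
Proof.
by rewrite -(card_ord m) -card_draws -cardsT -card_powerset subset_leq_card //;
   apply/fintype.subsetP => A _; rewrite !inE finset.subsetT.
Qed.

Lemma fact_le_expn (n : nat) : (n`! <= n ^ n)%N.
Proof.
elim: n => // n IHn; rewrite factS expnS leq_mul2l /=.
by apply: leq_trans IHn _; case: n => // n; rewrite leq_exp2r.
Qed.

(** Here [D = c j] and [L = n j]: the tree shapes cost [n ^ (n j)] since
    [4 ^ c <= n], the extra edges [n ^ (3 n j)] since each one is a choice among
    [n (D + 1) ^ 4 < n ^ 3], and the relabelings at most [n ^ (n j)]. *)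
Lemma code_count_le (n j c : nat) : (0 < j)%N -> (6 < c < 576)%N ->
  ((64 * j) ^ 4 <= n)%N -> (2 ^ (2 * c) <= n)%N ->
  ('C(c * j + c * j, c * j) ^ n * (n * (c * j).+1 ^ 4).+1 ^ (n * j) * n`!
   <= n ^ (5 * (n * j)))%N.
Proof.
move=> j0 /andP [c6 c576] jn cn.
have n_big : (2 ^ 13 <= n)%N.
  by apply: leq_trans cn; rewrite leq_exp2l //; lia.
have n0 : (0 < n)%N by apply: leq_trans n_big.
have h1 : ('C(c * j + c * j, c * j) ^ n <= n ^ (n * j))%N.
  apply: leq_trans (_ : (2 ^ (2 * c)) ^ (n * j) <= _)%N.
    rewrite -expnM; apply: leq_trans (_ : (2 ^ (c * j + c * j)) ^ n <= _)%N.
      by rewrite leq_exp2r // bin_le_exp2.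
    rewrite -expnM; apply: leq_pexp2l => //.
    by apply: eq_leq; ring.
  by rewrite leq_exp2r // muln_gt0 n0.
have h2 : ((n * (c * j).+1 ^ 4).+1 ^ (n * j) <= n ^ (3 * (n * j)))%N.
  rewrite [X in (_ <= X)%N]expnM leq_exp2r ?muln_gt0 ?n0 //.
  have : ((c * j).+1 ^ 4 <= 9 ^ 4 * n)%N.
    apply: leq_trans (_ : (9 * (64 * j)) ^ 4 <= _)%N.
      by rewrite leq_exp2r //; nia.
    by rewrite expnMn leq_mul.
  have : (9 ^ 4 < 2 ^ 13)%N by [].
  move: (9 ^ 4)%N (2 ^ 13)%N ((c * j).+1 ^ 4)%N n_big => u w q wn uw qn.
  have h : (n * q <= n * (u * n))%N by rewrite leq_mul2l qn orbT.
  have h' : (u.+1 * (n * n) <= n * (n * n))%N.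
    by rewrite leq_mul2r (leq_trans uw wn) orbT.
  rewrite !expnS expn0 muln1; apply: leq_trans h'.
  rewrite mulSn -addn1 addnC leq_add ?muln_gt0 ?n0 //.
  by rewrite mulnCA in h.
have h3 : (n`! <= n ^ (n * j))%N.
  apply: leq_trans (fact_le_expn n) _.
  by rewrite leq_exp2l ?leq_pmulr //; apply: leq_trans n_big.
apply: leq_trans (leq_mul (leq_mul h1 h2) h3) _.
by rewrite -!expnD; apply: leq_pexp2l => //; apply: eq_leq; ring.
Qed.

Section Asymptotics.
Variable R : realType.

(** The bound for [D = c j], [L = n j] and [M = 8 n j], where [j] is the mean
    degree up to constants. The choice of [M] balances two needs: with
    [p <= n ^ (- 3 / 4)], the mass [p ^+ M <= n ^ (- 6 n j)] must beat the
    [n ^ (5 n j)] codes, while [M] must stay well below the mean number of edges,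
    at least [32 (n - 1) j]. The remaining term is the cost of the extra edges:
    there are about [(n p) ^ 5] of them on average, against [L], which is
    of order [n ^ 2 p]; the ratio is of order [n ^ 3 p ^ 4]. *)
Lemma prob_reconstructable_bound (n j c : nat) (p : R) :
  0 <= p <= 1 -> (0 < j)%N -> (512 <= c < 576)%N ->
  64%:R * j%:R <= n%:R * p -> n%:R * p <= 128%:R * j%:R ->
  n%:R ^+ 3 * p ^+ 4 <= 1 -> (2 ^ (2 * c) <= n)%N ->
  n%:R ^+ 2 <= expR (n%:R * p) ->
  gnp_prob p (fun G : sgraph 'I_n => reconstructable 2 G)
  <= 3%:R / n%:R + 640%:R * (n%:R ^+ 3 * p ^+ 4).
Proof.
move=> p01 j0 /andP [c512 c576] dlo dhi p4 cn nexp.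
have c6 : (6 < c < 576)%N by rewrite c576 andbT; apply: leq_trans c512.
case/andP: (p01) => p0 p1.
have n_big : (2 ^ 13 <= n)%N.
  by apply: leq_trans cn; rewrite leq_exp2l //; lia.
have n0 : (0 < n)%N by apply: leq_trans n_big.
have nR0 : 0 < n%:R :> R by rewrite ltr0n.
have jR1 : 1 <= j%:R :> R by rewrite ler1n.
have jR0 : 0 < j%:R :> R by rewrite ltr0n.
set d := n%:R * p in dlo dhi nexp *.
have d1 : 1 <= d by lra.
have e2 : 2%:R <= expR 1 :> R by have := expR_ge1Dx (1 : R); lra.
(* Degrees: [2 ^ (- c j)] beats [(1 + p) ^ n <= expR d] as [c j >= 4 d]. *)
have t1 : n%:R * (2%:R^-1 ^+ (c * j) * (1 + p) ^+ n) <= n%:R^-1.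
  have h : 2%:R^-1 ^+ (c * j) <= expR (- (2%:R * d)).
    apply: (@le_trans _ _ (expR (- 2%:R^-1) ^+ (c * j))).
      rewrite lerXn2r ?nnegrE ?invr_ge0 ?expR_ge0 //.
      by have := expR_ge1Dx (- 2%:R^-1 : R); lra.
    rewrite -expRM_natl ler_expR natrM.
    have : 512%:R * j%:R <= c%:R * j%:R :> R by rewrite ler_wpM2r // ler_nat.
    by move: (c%:R * j%:R) => q; lra.
  have h' : (1 + p) ^+ n <= expR d.
    by rewrite /d expRM_natl lerXn2r ?nnegrE ?expR_ge0 ?expR_ge1Dx ?addr_ge0.
  apply: (@le_trans _ _ (n%:R * (expR (- (2%:R * d)) * expR d))).
    by rewrite ler_wpM2l // ler_pM ?exprn_ge0 ?invr_ge0 ?addr_ge0.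
  rewrite -expRD (_ : _ + d = - d); last by ring.
  by rewrite expRN ler_pdivrMr ?expR_gt0 // mulrC ler_pdivlMr.
(* Edges: the exponent is at most [8 n j - 16 (n - 1) j <= - n]. *)
have t2 : 2%:R ^+ (8 * (n * j)) * (1 - p / 2%:R) ^+ 'C(n, 2) <= n%:R^-1.
  have h : 2%:R ^+ (8 * (n * j)) <= expR ((8 * (n * j))%:R : R).
    by rewrite -[X in expR X]mulr1 expRM_natl lerXn2r ?nnegrE ?expR_ge0.
  have h' : (1 - p / 2%:R) ^+ 'C(n, 2) <= expR ('C(n, 2)%:R * - (p / 2%:R)).
    rewrite expRM_natl lerXn2r ?nnegrE ?expR_ge0 ?expR_ge1Dx //.
    by rewrite subr_ge0; lra.
  apply: (@le_trans _ _ (expR ((8 * (n * j))%:R : R)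
      * expR ('C(n, 2)%:R * - (p / 2%:R)))).
    by rewrite ler_pM ?exprn_ge0 // subr_ge0; lra.
  rewrite -expRD; apply: (@le_trans _ _ (expR (- n%:R))); last first.
    rewrite expRN lef_pV2 ?posrE ?expR_gt0 //.
    by have := expR_ge1Dx (n%:R : R); lra.
  rewrite ler_expR.
  have bin2 : 'C(n, 2)%:R * 2%:R = n%:R * (n%:R - 1) :> R.
    by rewrite -natrM mulnC -mul_bin_diag bin1 natrM -subn1 natrB.
  have n8 : 3%:R <= n%:R :> R by rewrite ler_nat; apply: leq_trans n_big.
  rewrite !natrM.
  have -> : 'C(n, 2)%:R * - (p / 2%:R) = - (d * (n%:R - 1) / 4%:R).
    have -> : 'C(n, 2)%:R = n%:R * (n%:R - 1) / 2%:R :> R by rewrite -bin2 mulfK.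
    by rewrite /d; field.
  have aux (x y z : R) : 64%:R * y <= z -> 3%:R <= x -> 1 <= y ->
      8%:R * (x * y) - z * (x - 1) / 4%:R <= - x.
    move=> hz hx hy.
    have : 64%:R * y * (x - 1) <= z * (x - 1) by rewrite ler_wpM2r //; lra.
    have : 0 <= (x - 3%:R) * (y - 1) by rewrite mulr_ge0 //; lra.
    lra.
  exact: aux.
have t3 : 5%:R * d ^+ 5 / (n * j).+1%:R <= 640%:R * (n%:R ^+ 3 * p ^+ 4).
  rewrite ler_pdivrMr ?ltr0n //.
  have -> : 5%:R * d ^+ 5 = (n%:R ^+ 3 * p ^+ 4) * (5%:R * d * n%:R).
    by rewrite /d; ring.
  rewrite [640%:R * _]mulrC -[leRHS]mulrA.
  rewrite ler_wpM2l ?mulr_ge0 ?exprn_ge0 //.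
  have -> : (n * j).+1%:R = n%:R * j%:R + 1 :> R by rewrite -natrM natr1.
  have : d * n%:R <= 128%:R * j%:R * n%:R by rewrite ler_wpM2r.
  by lra.
have t4 : ('C(c * j + c * j, c * j) ^ n * (n * (c * j).+1 ^ 4).+1 ^ (n * j)
    * n`!)%:R * p ^+ (8 * (n * j)) <= n%:R^-1 :> R.
  have jn : ((64 * j) ^ 4 <= n)%N.
    rewrite -(ler_nat R) natrX natrM.
    apply: (@le_trans _ _ (d ^+ 4)); first by rewrite lerXn2r ?nnegrE ?mulr_ge0.
    rewrite (_ : d ^+ 4 = n%:R * (n%:R ^+ 3 * p ^+ 4)); last by rewrite /d; ring.
    by rewrite ler_piMr.
  have h := code_count_le j0 c6 jn cn.
  apply: (@le_trans _ _ (n%:R ^+ (5 * (n * j)) * p ^+ (8 * (n * j)))).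
    by rewrite ler_wpM2r ?exprn_ge0 // -natrX ler_nat.
  have pM : p ^+ (8 * (n * j)) <= (n%:R ^+ (6 * (n * j)))^-1.
    rewrite -div1r ler_pdivlMr ?exprn_gt0 // mulrC.
    rewrite (_ : 6 * (n * j) = 3 * (2 * (n * j)))%N; last by ring.
    rewrite (_ : 8 * (n * j) = 4 * (2 * (n * j)))%N; last by ring.
    rewrite [n%:R ^+ _]exprM [p ^+ _]exprM -exprMn.
    by apply: exprn_ile1; rewrite ?mulr_ge0 ?exprn_ge0.
  apply: (@le_trans _ _ (n%:R ^+ (5 * (n * j)) * (n%:R ^+ (6 * (n * j)))^-1)).
    by rewrite ler_wpM2l ?exprn_ge0.
  rewrite (_ : 6 * (n * j) = 5 * (n * j) + n * j)%N; last by ring.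
  rewrite exprD invfM mulrA mulfV ?mul1r ?expf_neq0 ?gt_eqF //.
  rewrite lef_pV2 ?posrE ?exprn_gt0 // ler_eXnr ?muln_gt0 ?n0 //.
  by rewrite ler1n.
apply: le_trans (prob_reconstructable_le p01 (c * j) (n * j) (8 * (n * j)) d1) _.
apply: le_trans (lerD (lerD (lerD t1 t2) t3) t4) _.
by rewrite le_eqVlt; apply/orP; left; apply/eqP; ring.
Qed.

End Asymptotics.

Local Open Scope classical_set_scope.
Local Open Scope ring_scope.

Lemma near_powR_ge (R : realType) (g A : R) :
  0 < g -> \forall n \near \oo, A <= n%:R `^ g.
Proof.
move=> g0; have := @cvgr_idn R.
move/cvgryPge => /(_ (`|A| `^ g^-1)); apply: filterS => n h.
apply: (le_trans (ler_norm A)).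
have -> : `|A| = (`|A| `^ g^-1) `^ g.
  by rewrite -powRrM mulVf ?gt_eqF // powRr1.
by rewrite ge0_ler_powR ?nnegrE ?powR_ge0 // ltW.
Qed.

Theorem theorem5 (R : realType) (alpha : R)
    (halpha : 3%:R / 4%:R < alpha < 1) :
  (fun n : nat => gnp_prob (n%:R `^ (- alpha))
     (fun G : sgraph 'I_n => ~ reconstructable 2 G)) @ \oo --> (1 : R).
Proof.
case/andP: halpha => a34 a1.
pose b := 1 - alpha; have b0 : 0 < b by rewrite subr_gt0.
pose g := 4%:R * alpha - 3%:R; have g0 : 0 < g by rewrite /g; lra.
apply/cvgrPdist_le => eps eps0.
have n1 := @near_powR_ge R 1 (2%:R ^+ (2 * 512)) ltr01.
have n2 := @near_powR_ge R 1 (6%:R / eps) ltr01.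
have n3 := @near_powR_ge R b 64%:R b0.
have n4 := @near_powR_ge R (b / 2%:R) (4%:R / b) (divr_gt0 b0 (ltr0Sn _ 1)).
have n5 := @near_powR_ge R g 1 g0.
have n6 := @near_powR_ge R g (1280%:R / eps) g0.
near=> n.
have n2k : 2%:R ^+ (2 * 512) <= n%:R :> R.
  by rewrite -[leRHS]powRr1 ?ler0n //; near: n.
have neps : 6%:R / eps <= n%:R :> R.
  by rewrite -[leRHS]powRr1 ?ler0n //; near: n.
have nb : 64%:R <= n%:R `^ b by near: n.
have nb2 : 4%:R / b <= n%:R `^ (b / 2%:R) by near: n.
have ng1 : 1 <= n%:R `^ g by near: n.
have nge : 1280%:R / eps <= n%:R `^ g by near: n.
have n1' : 1 <= n%:R :> R.
  by apply: le_trans n2k; rewrite exprn_ege1 // ler1n.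
have nR0 : 0 < n%:R :> R by apply: lt_le_trans n1'.
have nz : n%:R != 0 :> R by rewrite gt_eqF.
set p : R := n%:R `^ (- alpha).
have p01 : 0 <= p <= 1.
  rewrite powR_ge0 /= -[leRHS](powRr0 n%:R) ler_powR // oppr_le0.
  by lra.
have np : n%:R * p = n%:R `^ b.
  by rewrite -[X in X * _]powRr1 ?ler0n // -powRD ?nz ?implybT.
have n3p4 : n%:R ^+ 3 * p ^+ 4 = (n%:R `^ g)^-1.
  rewrite /p -!powR_mulrn ?powR_ge0 // -powRrM -powRD ?nz ?implybT //.
  by rewrite -powRN /g; congr (_ `^ _); ring.
(* The integer part of [n p / 64], for [n p = n `^ b]. *)
have [j jlo jhi] : exists2 j : nat,
    64%:R * j%:R <= n%:R `^ b & n%:R `^ b < 64%:R * (j%:R + 1).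
  have h : 0 <= n%:R `^ b / 64%:R by rewrite divr_ge0 ?powR_ge0.
  have /andP [h1 h2] := truncn_itv h.
  exists (Num.truncn (n%:R `^ b / 64%:R)).
    by rewrite mulrC -ler_pdivlMr.
  by rewrite mulrC -ltr_pdivrMr // natr1.
have j0 : (0 < j)%N by rewrite -(ltr0n R); lra.
have j1 : 1 <= j%:R :> R by rewrite ler1n.
have nexp : n%:R ^+ 2 <= expR (n%:R * p) :> R.
  rewrite np -[X in X ^+ 2]lnK ?posrE // -expRM_natl ler_expR.
  have hb : n%:R `^ b = n%:R `^ (b / 2%:R) * n%:R `^ (b / 2%:R).
    by rewrite -powRD ?nz ?implybT // -splitr.
  (* A logarithm is below any power: apply [ln x <= x] to [x = n `^ (b / 2)]. *)
  have hl : b / 2%:R * ln n%:R <= n%:R `^ (b / 2%:R).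
    have x0 : 0 < n%:R `^ (b / 2%:R) by rewrite powR_gt0.
    rewrite -ln_powR; move: x0; move: (_ `^ _) => x x0.
    by have := @le_ln1Dx R (x - 1); rewrite addrCA subrr addr0; lra.
  rewrite hb; apply: (@le_trans _ _ (4%:R / b * n%:R `^ (b / 2%:R))); last first.
    by rewrite ler_wpM2r ?powR_ge0.
  rewrite -ler_pdivrMl ?divr_gt0 //; apply: le_trans hl.
  by rewrite le_eqVlt; apply/orP; left; apply/eqP; field; rewrite gt_eqF.
rewrite gnp_prob_compl opprB addrC subrK.
rewrite ger0_norm ?gnp_prob_ge0 //.
apply: le_trans (@prob_reconstructable_bound R n j 512 p p01 j0 isT _ _ _ _ nexp) _.
- by rewrite np.
- by rewrite np; lra.
- by rewrite n3p4 invf_le1 // (lt_le_trans ltr01).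
- by rewrite -(ler_nat R) natrX.
rewrite n3p4.
have h1 : 3%:R / n%:R <= eps / 2%:R.
  rewrite ler_pdivrMr //; move: neps; rewrite ler_pdivrMr // mulrC; lra.
have h2 : 640%:R * (n%:R `^ g)^-1 <= eps / 2%:R.
  rewrite ler_pdivrMr ?(lt_le_trans ltr01) //.
  by move: nge; rewrite ler_pdivrMr // mulrC; lra.
by lra.
Unshelve. all: by end_near.
Qed.
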